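(* Let $a\in\mathbb{R}\setminus\{0\}$, $T>0$, $n\ge 1$, and let $\gamma\in\mathcal{P}_T$ be a critical curve of $\mathcal{B}_a$ constrained by $\mathcal{A}$ in the standard symplectic vector space $(\mathbb{R}^{2n},\omega)$. Then $\gamma$ is contained in a symplectic affine 2-plane of $(\mathbb{R}^{2n},\omega)$, i.e. in a translate of a 2-dimensional linear subspace on which $\omega$ is non-degenerate.
   Context: A smooth closed curve $\gamma$ in $(\mathbb{R}^{2n},\omega)$ is symplectically star-shaped if $\omega(\gamma(t),\gamma'(t))>0$ for all $t$, and symplectically convex if $\omega(\gamma'(t),\gamma''(t))>0$ for all $t$. $\mathcal{P}_T$ denotes the space of smooth $T$-periodic curves $\gamma:\mathbb{R}\to\mathbb{R}^{2n}$ that are both symplectically star-shaped and symplectically convex. Define $\mathcal{A}(\gamma)=\int_0^T\omega(\gamma,\gamma')\,dt$ and $\mathcal{B}_a(\gamma)=\int_0^T\omega(\gamma',\gamma'')^a\,dt$. A curve $\gamma\in\mathcal{P}_T$ is a critical curve (relative extremum of $\mathcal{B}_a$ constrained by $\mathcal{A}$) if there is a Lagrange multiplier $\lambda\in\mathbb{R}$ such that for every smooth $T$-periodic vector field $v:\mathbb{R}\to\mathbb{R}^{2n}$ one has $\frac{d}{d\varepsilon}\big|_{\varepsilon=0}\big[\lambda\mathcal{A}(\gamma+\varepsilon v)+\mathcal{B}_a(\gamma+\varepsilon v)\big]=0$. *)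

(* Defs.v *)
From HB Require Import structures.
From mathcomp Require Import all_boot all_order all_algebra.
From mathcomp Require Import all_classical all_reals all_analysis.

Set Implicit Arguments.
Unset Strict Implicit.
Unset Printing Implicit Defensive.

Import Order.TTheory GRing.Theory Num.Theory.
Import numFieldNormedType.Exports.

Local Open Scope classical_set_scope.
Local Open Scope ring_scope.

(* R^{2n} is 'rV[R]_(n + n): the first n coordinates are x_1, ..., x_n and the
   last n are y_1, ..., y_n, so that omega = sum_i dx_i /\ dy_i. *)
Definition omega (R : realType) (n : nat) (u v : 'rV[R]_(n + n)) : R :=
  \sum_(i < n) (u 0 (lshift n i) * v 0 (rshift n i)
                - u 0 (rshift n i) * v 0 (lshift n i)).

Definition smooth (R : realType) (m : nat) (g : R -> 'rV[R]_m) : Prop :=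
  forall (k : nat) (t : R), derivable (derive1n k g) t 1.

Definition sympl_star_shaped (R : realType) (n : nat)
    (g : R -> 'rV[R]_(n + n)) : Prop :=
  forall t : R, 0 < omega (g t) (derive1 g t).

Definition sympl_convex (R : realType) (n : nat)
    (g : R -> 'rV[R]_(n + n)) : Prop :=
  forall t : R, 0 < omega (derive1 g t) (derive1n 2 g t).

(* T is a period, not necessarily the least one. *)
Definition smooth_periodic (R : realType) (m : nat) (T : R)
    (g : R -> 'rV[R]_m) : Prop :=
  smooth g /\ periodic g T.

Definition curve_space (R : realType) (n : nat) (T : R) :
    set (R -> 'rV[R]_(n + n)) :=
  [set g | [/\ smooth_periodic T g, sympl_star_shaped g & sympl_convex g]].

Definition area (R : realType) (n : nat) (T : R)
    (g : R -> 'rV[R]_(n + n)) : R :=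
  \int[lebesgue_measure]_(t in `[0, T]) omega (g t) (derive1 g t).

Definition affine_energy (R : realType) (n : nat) (T a : R)
    (g : R -> 'rV[R]_(n + n)) : R :=
  \int[lebesgue_measure]_(t in `[0, T]) (omega (derive1 g t) (derive1n 2 g t) `^ a).

(* The perturbed curve need only be symplectically convex for small e, which is
   all that the derivative at e = 0 sees; elsewhere powR takes junk values. *)
Definition critical_curve (R : realType) (n : nat) (T a : R)
    (g : R -> 'rV[R]_(n + n)) : Prop :=
  exists lambda : R, forall v : R -> 'rV[R]_(n + n), smooth_periodic T v ->
    is_derive (0 : R) (1 : R)
      (fun e : R => lambda * area T (fun t => g t + e *: v t)
                    + affine_energy T a (fun t => g t + e *: v t))
      0.

Definition symplectic_subspace (R : realType) (n : nat)
    (U : {vspace 'rV[R]_(n + n)}) : Prop :=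
  forall u, u \in U -> (forall v, v \in U -> omega u v = 0) -> u = 0.

(* Main.v *)
(* Put h = omega(g', g''), f = a h^(a-1) and w = 2 f g'' + f' g' - 2 lambda g.
   Integrating by parts, the first variation along v is - \int omega(v, w').
   Since w is smooth and periodic, v = J w' is an admissible field, with J such
   that omega(J x, x) = |x|^2; hence w' = 0, i.e.
     2 f g'' + f' g' = 2 lambda g + c.
   If lambda = 0, then omega(g, c) is periodic with derivative
   omega(g', c) = 2 f h = 2 a h^a, which never vanishes: this contradicts Rolle.
   Otherwise d = g + c / (2 lambda) satisfies 2 f d'' + f' d' = 2 lambda d, so
   lambda omega(d, d') = - f h never vanishes, d and d' span a symplectic plane,
   and the symplectic projection onto this plane has derivative 0: the plane is
   fixed and contains d(t) for all t. *)

Require Import Defs.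
From HB Require Import structures.
From mathcomp Require Import all_boot all_order all_algebra.
From mathcomp Require Import all_classical all_reals all_analysis.
From mathcomp Require Import ring lra.
Import Order.TTheory GRing.Theory Num.Theory.
Import numFieldNormedType.Exports.
Local Open Scope classical_set_scope.
Local Open Scope ring_scope.

(** * Bilinear algebra of the symplectic form and its compatible complex structure *)

Section omega_algebra.
Context {R : realType} {n : nat}.
Implicit Types (u v w : 'rV[R]_(n + n)) (c : R).

Lemma omegaDl u v w : omega (u + v) w = omega u w + omega v w.
Proof.
by rewrite /omega -big_split; apply: eq_bigr => i _; rewrite !mxE /=; ring.
Qed.

Lemma omegaZl c u v : omega (c *: u) v = c * omega u v.
Proof.
by rewrite /omega mulr_sumr; apply: eq_bigr => i _; rewrite !mxE; ring.
Qed.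

Lemma omegaC u v : omega u v = - omega v u.
Proof. by rewrite /omega -sumrN; apply: eq_bigr => i _; ring. Qed.

Lemma omegaDr u v w : omega w (u + v) = omega w u + omega w v.
Proof. by rewrite omegaC omegaDl opprD -!(omegaC w). Qed.

Lemma omegaZr c u v : omega v (c *: u) = c * omega v u.
Proof. by rewrite omegaC omegaZl -mulrN -omegaC. Qed.

Lemma omegaNl u v : omega (- u) v = - omega u v.
Proof. by rewrite -scaleN1r omegaZl mulN1r. Qed.

Lemma omegaNr u v : omega u (- v) = - omega u v.
Proof. by rewrite -scaleN1r omegaZr mulN1r. Qed.

Lemma omegaxx u : omega u u = 0.
Proof. by rewrite /omega big1// => i _; ring. Qed.

Lemma omega0l u : omega 0 u = 0.
Proof. by rewrite -(scale0r 0) omegaZl mul0r. Qed.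

Definition omegaE :=
  (omegaDl, omegaDr, omegaNl, omegaNr, omegaZl, omegaZr, omegaxx).

(* The complex structure for which [omega (compatible_J u) u] is the squared
   Euclidean norm of [u]. *)
Definition compatible_J u : 'rV[R]_(n + n) := row_mx (rsubmx u) (- lsubmx u).

Lemma omega_J u : omega (compatible_J u) u =
  \sum_(i < n) (u 0 (rshift n i) ^+ 2 + u 0 (lshift n i) ^+ 2).
Proof.
by apply: eq_bigr => i _; rewrite row_mxEl row_mxEr !mxE; ring.
Qed.

Lemma omega_J_ge0 u : 0 <= omega (compatible_J u) u.
Proof. by rewrite omega_J sumr_ge0// => i _; rewrite addr_ge0 ?sqr_ge0. Qed.

Lemma omega_J_eq0 u : omega (compatible_J u) u = 0 -> u = 0.
Proof.
rewrite omega_J => /eqP; rewrite psumr_eq0; last first.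
  by move=> i _; rewrite addr_ge0 ?sqr_ge0.
move=> /allP u0; apply/rowP => j; rewrite mxE.
have {}u0 i : u 0 (rshift n i) = 0 /\ u 0 (lshift n i) = 0.
  have := u0 i (mem_index_enum _).
  by rewrite paddr_eq0 ?sqr_ge0// !sqrf_eq0 => /andP[/eqP-> /eqP->].
by case: (split_ordP j) => i ->; case: (u0 i).
Qed.

End omega_algebra.

(** * Derivatives of vector-valued curves and Leibniz rules *)

Section vector_derivatives.
Context {R : realType}.

Lemma is_derive_mxP {V : normedModType R} m k (M : V -> 'M[R]_(m, k)) t v dM :
  is_derive t v M dM <->
  forall i j, is_derive t v (fun x => M x i j) (dM i j).
Proof.
split=> [[dMt <-] i j|dMij].
  apply: DeriveDef; first by move/derivable_mxP : dMt; apply.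
  by rewrite derive_mx// mxE.
have dMt : derivable M t v by apply/derivable_mxP => i j; have [] := dMij i j.
apply: DeriveDef => //; rewrite derive_mx//.
by apply/matrixP => i j; rewrite mxE; have [_ ->] := dMij i j.
Qed.

Lemma is_derive1P {V : normedModType R} (u : R -> V) (t : R) du :
  is_derive t (1 : R) u du <-> derivable u t (1 : R) /\ (derive1 u) t = du.
Proof.
split=> [[? <-]|[? <-]]; first by rewrite derive1E.
by apply: DeriveDef => //; rewrite derive1E.
Qed.

Lemma derivable_is_derive1 {V : normedModType R} (u : R -> V) (t : R) :
  derivable u t (1 : R) -> is_derive t (1 : R) u ((derive1 u) t).
Proof. by move=> ?; apply/is_derive1P. Qed.

Lemma is_derive1_mul (f h : R -> R) (t : R) (df dh : R) :
  is_derive t (1 : R) f df -> is_derive t (1 : R) h dh ->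
  is_derive t (1 : R) (fun x => f x * h x) (df * h t + f t * dh).
Proof.
move=> Hf Hh; have := is_deriveM Hf Hh => H; apply: is_derive_eq.
by rewrite /GRing.scale /= addrC (mulrC (h t)).
Qed.

Lemma is_derive_scale m (f : R -> R) (u : R -> 'rV[R]_m) (t : R) df du :
  is_derive t (1 : R) f df -> is_derive t (1 : R) u du ->
  is_derive t (1 : R) (fun x => f x *: u x) (df *: u t + f t *: du).
Proof.
move=> Hf /is_derive_mxP Hu; apply/is_derive_mxP => i j.
rewrite !mxE (_ : (fun x => _) = (fun x => f x * u x i j)).
  exact: is_derive1_mul.
by apply/funext => x; rewrite mxE.
Qed.

Lemma is_derive_omega n (u v : R -> 'rV[R]_(n + n)) (t : R) du dv :
  is_derive t (1 : R) u du -> is_derive t (1 : R) v dv ->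
  is_derive t (1 : R) (fun x => omega (u x) (v x))
    (omega du (v t) + omega (u t) dv).
Proof.
move=> /is_derive_mxP Hu /is_derive_mxP Hv.
rewrite /omega -big_split /=.
rewrite (_ : (fun x => _) = \sum_(i < n)
    (fun x => u x 0 (lshift n i) * v x 0 (rshift n i)
            - u x 0 (rshift n i) * v x 0 (lshift n i))); last first.
  by apply/funext => x; rewrite fct_sumE.
apply: is_derive_sum => i.
have H1 := is_derive1_mul _ _ _ _ _ (Hu 0 (lshift n i)) (Hv 0 (rshift n i)).
have H2 := is_derive1_mul _ _ _ _ _ (Hu 0 (rshift n i)) (Hv 0 (lshift n i)).
have H := is_deriveB H1 H2; apply: is_derive_eq; ring.
Qed.

Lemma is_derive_J n (u : R -> 'rV[R]_(n + n)) (t : R) du :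
  is_derive t (1 : R) u du ->
  is_derive t (1 : R) (fun x => compatible_J (u x)) (compatible_J du).
Proof.
move=> /is_derive_mxP Hu; apply/is_derive_mxP => i j.
case: (split_ordP j) => k ->.
  rewrite row_mxEl mxE (_ : (fun x => _) = (fun x => u x i (rshift n k)))//.
  by apply/funext => x; rewrite row_mxEl mxE.
rewrite row_mxEr !mxE (_ : (fun x => _) = - (fun x => u x i (lshift n k))).
  exact: is_deriveN.
by apply/funext => x; rewrite row_mxEr !mxE.
Qed.

Lemma is_derive_powR (h : R -> R) (b t dh : R) : 0 < h t ->
  is_derive t (1 : R) h dh ->
  is_derive t (1 : R) (fun x => h x `^ b) (b * h t `^ (b - 1) * dh).
Proof.
by move=> h0 Hh; have H := is_derive1_powR b h0; exact: is_derive1_comp.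
Qed.

Lemma derive0_cst m (u : R -> 'rV[R]_m) :
  (forall t : R, is_derive t (1 : R) u 0) -> forall s t, u s = u t.
Proof.
move=> Hu s t; apply/rowP => j.
apply: (@is_derive_0_is_cst R (fun x => u x 0 j)) => x.
by have /is_derive_mxP/(_ 0 j) := Hu x; rewrite mxE.
Qed.

End vector_derivatives.

(** * Stability of smoothness under the operations of the proof *)

Section times_derivable.
Context {R : realType}.

(** A finite-order form of smoothness, available for scalar functions as well as curves. Peeling off
    the innermost derivative lets closure properties go by induction on [k] with the function
    generalized. *)
Fixpoint times_derivable {V : normedModType R} k (u : R -> V) : Prop :=
  if k is k'.+1 then
    (forall t : R, derivable u t (1 : R)) /\ times_derivable k' (derive1 u)
  else True.

Lemma times_derivableW {V : normedModType R} k (u : R -> V) :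
  times_derivable k.+1 u -> times_derivable k u.
Proof. by elim: k u => [//|k IH] u [du /IH]. Qed.

Lemma smoothP m (u : R -> 'rV[R]_m) :
  smooth u <-> forall k, times_derivable k u.
Proof.
split=> [Hu k|].
  elim: k u Hu => [//|k IH] u Hu; split=> [t|]; first exact: (Hu 0).
  by apply: IH => j t; rewrite -derive1Sn; exact: Hu.
move=> Hu k; elim: k u Hu => [|k IH] u Hu t.
  by rewrite derive1n0; have [] := Hu 1.
by rewrite derive1Sn; apply: IH => j; have [] := Hu j.+1.
Qed.

Lemma is_derive1_funext {V : normedModType R} (u du : R -> V) :
  (forall t : R, is_derive t (1 : R) u (du t)) -> (derive1 u) = du.
Proof. by move=> H; apply/funext => t; have /is_derive1P[] := H t. Qed.

Lemma times_derivableS {V : normedModType R} k (u du : R -> V) :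
  (forall t : R, is_derive t (1 : R) u (du t)) -> times_derivable k du ->
  times_derivable k.+1 u.
Proof.
move=> H Hdu; split; last by rewrite (is_derive1_funext _ _ H).
by move=> t; have /is_derive1P[] := H t.
Qed.

Lemma times_derivableD {V : normedModType R} k (u v : R -> V) :
  times_derivable k u -> times_derivable k v ->
  times_derivable k (fun t => u t + v t).
Proof.
elim: k u v => [//|k IH] u v [du Hu] [dv Hv].
apply: times_derivableS (IH _ _ Hu Hv) => t.
by apply: is_deriveD; exact: derivable_is_derive1.
Qed.

Lemma times_derivable_cst {V : normedModType R} k (c : V) :
  times_derivable k (fun _ : R => c).
Proof.
by elim: k c => [|k IH] c; [|apply: times_derivableS (IH 0)].
Qed.

(** One induction serves every product: by [Leibniz], the derivative of [B u v] is a sum of two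
    terms of the same shape, whose factors are still derivable [k] times. *)
Lemma times_derivable_product {U V W : normedModType R} (B : U -> V -> W)
    (Leibniz : forall (u : R -> U) (v : R -> V) (t : R) du dv,
      is_derive t (1 : R) u du -> is_derive t (1 : R) v dv ->
      is_derive t (1 : R) (fun x => B (u x) (v x)) (B du (v t) + B (u t) dv))
    k (u : R -> U) (v : R -> V) :
  times_derivable k u -> times_derivable k v ->
  times_derivable k (fun t => B (u t) (v t)).
Proof.
elim: k u v => [//|k IH] u v Hu Hv.
have [du Hdu] := Hu; have [dv Hdv] := Hv.
apply: (@times_derivableS _ _ _
  (fun t => B (derive1 u t) (v t) + B (u t) (derive1 v t))).
  by move=> t; apply: Leibniz; exact: derivable_is_derive1.
by apply: times_derivableD; apply: IH => //; exact: times_derivableW.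
Qed.

Lemma times_derivableM k (f h : R -> R) :
  times_derivable k f -> times_derivable k h ->
  times_derivable k (fun t => f t * h t).
Proof. exact: (times_derivable_product _ (@is_derive1_mul R)). Qed.

Lemma times_derivableZ m k (f : R -> R) (u : R -> 'rV[R]_m) :
  times_derivable k f -> times_derivable k u ->
  times_derivable k (fun t => f t *: u t).
Proof. exact: (times_derivable_product _ (@is_derive_scale R m)). Qed.

Lemma times_derivable_omega n k (u v : R -> 'rV[R]_(n + n)) :
  times_derivable k u -> times_derivable k v ->
  times_derivable k (fun t => omega (u t) (v t)).
Proof. exact: (times_derivable_product _ (@is_derive_omega R n)). Qed.

Lemma times_derivable_J n k (u : R -> 'rV[R]_(n + n)) :
  times_derivable k u -> times_derivable k (fun t => compatible_J (u t)).
Proof.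
elim: k u => [//|k IH] u [du Hu]; apply: times_derivableS (IH _ Hu) => t.
by apply: is_derive_J; exact: derivable_is_derive1.
Qed.

Lemma times_derivable_powR k (h : R -> R) b : (forall t, 0 < h t) ->
  times_derivable k h -> times_derivable k (fun t => h t `^ b).
Proof.
(* The exponent is generalized because each differentiation lowers it by one. *)
move=> h0; elim: k b => [//|k IH] b Hh; have [dh Hdh] := Hh.
apply: (@times_derivableS _ _ _ (fun t => b * h t `^ (b - 1) * (derive1 h) t)).
  by move=> t; apply: is_derive_powR => //; exact: derivable_is_derive1.
do 2?[apply: times_derivableM => //]; first exact: times_derivable_cst.
by apply: IH; exact: times_derivableW.
Qed.

End times_derivable.

(** * Periodic functions and reduction to one period *)

Section periodic.
Context {R : realType}.

Lemma periodic_derive1 {V : normedModType R} (T : R) (u : R -> V) :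
  periodic u T -> periodic (derive1 u) T.
Proof.
move=> uT t; rewrite /derive1.
rewrite (_ : (fun h => _) = fun h => h^-1 *: (u (h + t) - u t))//.
by apply/funext => h; rewrite addrA !uT.
Qed.

Lemma periodicz {V : zmodType} (T : R) (u : R -> V) :
  periodic u T -> forall t (k : int), u (t + k%:~R * T) = u t.
Proof.
move=> uT t k.
have uTn s m : u (s + m%:R * T) = u s.
  elim: m => [|m IH]; first by rewrite mul0r addr0.
  by rewrite -natr1 mulrDl mul1r addrA uT.
case: k => m; first exact: uTn.
by rewrite NegzE mulrNz mulNr -[in RHS](subrK (m.+1%:R * T) t) uTn.
Qed.

Lemma periodic_itv {V : zmodType} (T : R) (u : R -> V) : 0 < T ->
  periodic u T -> forall t, exists2 s, s \in `[0, T] & u t = u s.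
Proof.
(* Subtracting [k] periods, [k] being the integer part of [t / T], brings [t] into the base
   interval. *)
move=> T0 uT t; pose k := Num.floor (t / T).
exists (t + (- k)%:~R * T); last by rewrite periodicz.
have /andP[] : k%:~R <= t / T < (k + 1)%:~R by exact/real_floor_itv/num_real.
rewrite ler_pdivlMr// ltr_pdivrMr// intrD mulrDl mul1r => k1 k2.
by rewrite in_itv /= mulrNz mulNr subr_ge0 k1 lerBlDl ltW.
Qed.

End periodic.

(** * Integrals over a period and differentiation under the integral sign *)

Section integrals.
Context {R : realType}.
Local Notation mu := (@lebesgue_measure R).

Lemma derivable_continuous {V : normedModType R} (f : R -> V) :
  (forall t : R, derivable f t (1 : R)) -> continuous f.
Proof.
by move=> df t; exact/differentiable_continuous/derivable1_diffP.
Qed.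

Lemma continuous_integrable_itv (f : R -> R) (a b : R) :
  continuous f -> mu.-integrable `[a, b] (EFin \o f).
Proof.
move=> cf; apply: continuous_compact_integrable; first exact: segment_compact.
exact: continuous_subspaceT.
Qed.

Lemma Rintegral_derive_periodic (T : R) (G dG : R -> R) : 0 < T ->
  (forall t : R, is_derive t (1 : R) G (dG t)) -> continuous dG ->
  periodic G T -> \int[mu]_(t in `[0, T]) dG t = 0.
Proof.
move=> T0 HG cdG GT.
have cG : continuous G by apply: derivable_continuous => t; have [] := HG t.
rewrite /Rintegral (@continuous_FTC2 _ _ G)//.
- by rewrite -[T in G T]add0r GT -EFinB subrr.
- exact: continuous_subspaceT.
- split; first by move=> t _; have [] := HG t.
  + by apply: cvg_at_right_filter; exact: cG.
  + by apply: cvg_at_left_filter; exact: cG.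
- by move=> t _; have /is_derive1P[] := HG t.
Qed.

(** The integrals over [[0, x]] and [[x, T]] are both nonnegative and add up to 0, so the primitive
    [F] vanishes on the open interval. Its derivative there is [f] by the fundamental theorem of
    calculus, which is applied at interior points only. *)
Lemma continuous_Rintegral_eq0 (T : R) (f : R -> R) : continuous f ->
  (forall t, 0 <= f t) -> \int[mu]_(t in `[0, T]) f t = 0 ->
  forall t, 0 < t < T -> f t = 0.
Proof.
move=> cf f0 If0 t /andP[t0 tT].
pose F x := \int[mu]_(s in `[0, x]) f s.
have [dF <-] := @continuous_FTC1 R f (BLeft 0) t T tT
  (continuous_integrable_itv f 0 T cf) t0 (cf t).
rewrite derive1E -[RHS](derive_cst (0 : R) t (1 : R)).
apply: near_eq_derive.
have : \forall x \near t, x \in `]0, T[.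
  by apply: near_in_itvoo; rewrite in_itv /= t0.
apply: filterS => x; rewrite in_itv /= => /andP[x0 xT].
apply/eqP; rewrite eq_le Rintegral_ge0// andbT.
have := @Rintegral_itvB R f (BLeft 0) (BRight T) x
  (continuous_integrable_itv f 0 T cf).
rewrite !bnd_simp => /(_ (ltW x0) (ltW xT)); rewrite If0 sub0r => H.
by rewrite -oppr_ge0 [leRHS]H Rintegral_ge0.
Qed.

Lemma continuous_itv_norm_le (f : R -> R) (a b : R) : a <= b ->
  {within `[a, b], continuous f} ->
  exists2 M, 0 <= M & forall t, t \in `[a, b] -> `|f t| <= M.
Proof.
move=> ab cf.
have [|c _ Hc] := @EVT_max R (fun t => `|f t|) a b ab.
  by move=> t; apply: cvg_norm; exact: cf.
by exists `|f c|.
Qed.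

(** The argument of [phi] is quadratic in [e], as is [omega] along a perturbed curve. Since [phi] is
    only controlled on positive reals, as a real power is, [e] is confined to an interval on which
    this argument stays in a compact subset of the positive half-line; there the [e]-derivative of
    the integrand is bounded by a constant, and dominated differentiation applies. *)
Lemma is_derive_Rintegral_comp (T : R) (phi dphi p0 p1 p2 : R -> R) : 0 < T ->
  (forall x : R, 0 < x -> is_derive x (1 : R) phi (dphi x)) ->
  (forall x : R, 0 < x -> {for x, continuous dphi}) ->
  continuous p0 -> continuous p1 -> continuous p2 -> (forall t, 0 < p0 t) ->
  is_derive (0 : R) (1 : R)
    (fun e => \int[mu]_(t in `[0, T]) phi (p0 t + e * p1 t + e ^+ 2 * p2 t))
    (\int[mu]_(t in `[0, T]) (dphi (p0 t) * p1 t)).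
Proof.
move=> T0 Dphi cdphi c0 c1 c2 p0_gt0.
have [cm _ Hm] := EVT_min (ltW T0) (continuous_subspaceT c0).
set m := p0 cm in Hm.
have m0 : 0 < m by exact: p0_gt0.
have [M0 M0_ge0 HM0] :=
  continuous_itv_norm_le _ _ _ (ltW T0) (continuous_subspaceT c0).
have [M1 M1_ge0 HM1] :=
  continuous_itv_norm_le _ _ _ (ltW T0) (continuous_subspaceT c1).
have [M2 M2_ge0 HM2] :=
  continuous_itv_norm_le _ _ _ (ltW T0) (continuous_subspaceT c2).
pose M := m + M0 + M1 + M2.
have M_gt0 : 0 < M by rewrite /M; lra.
(* This radius makes [d * M = m / 4] and [d <= 1], hence [e ^+ 2 <= |e|]: each of the two
   perturbation terms is at most [m / 4], and the argument of [phi] stays in [[m / 2, 2 * M]]. *)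
pose d := m / (4 * M).
have d0 : 0 < d by rewrite divr_gt0// mulr_gt0.
have dM : d * M = m / 4 by rewrite /d; field; rewrite gt_eqF.
have d1 : d <= 1 by rewrite ler_pdivrMr ?mulr_gt0// /M; lra.
pose P e t := p0 t + e * p1 t + e ^+ 2 * p2 t.
have Ebnd e t : e \in `]-d, d[ -> t \in `[0, T] ->
    `|e * p1 t| <= m / 4 /\ `|e ^+ 2 * p2 t| <= m / 4.
  rewrite in_itv /= -ltr_norml => he ht; rewrite -dM !normrM.
  split.
    apply: ler_pM => //; first exact: ltW.
    by apply: le_trans (HM1 t ht) _; rewrite /M; lra.
  apply: ler_pM => //; last by apply: le_trans (HM2 t ht) _; rewrite /M; lra.
  by rewrite (le_trans _ (ltW he))// ler_piMl// (le_trans (ltW he)).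
have Pbnd e t : e \in `]-d, d[ -> t \in `[0, T] -> m / 2 <= P e t <= 2 * M.
  move=> he ht.
  have [E1 E2] := Ebnd e t he ht.
  have := Hm t ht; have /ler_normlP[? ?] := HM0 t ht.
  have /ler_normlP[? ?] := E1; have /ler_normlP[? ?] := E2.
  by move=> ?; rewrite /P /M; apply/andP; split; lra.
have P_gt0 e t : e \in `]-d, d[ -> t \in `[0, T] -> 0 < P e t.
  by move=> he ht; have /andP[+ _] := Pbnd e t he ht; lra.
have mM : m / 2 <= 2 * M by rewrite /M; lra.
have [K K_ge0 HK] : exists2 K, 0 <= K &
    forall x, x \in `[m / 2, 2 * M] -> `|dphi x| <= K.
  apply: continuous_itv_norm_le => //.
  apply: continuous_in_subspaceT => x; rewrite inE /= in_itv /= => /andP[mx _].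
  by apply: cdphi; lra.
have dP e t : is_derive e (1 : R) (P ^~ t) (p1 t + 2 * e * p2 t).
  have H1 := is_derive1_mul _ _ e _ _
    (is_derive_id e (1 : R)) (is_derive_cst (p1 t) e (1 : R)).
  have H2 := is_derive1_mul _ _ e _ _
    (is_derive_id e (1 : R)) (is_derive_id e (1 : R)).
  have H3 := is_derive1_mul _ _ e _ _ H2 (is_derive_cst (p2 t) e (1 : R)).
  have H4 := is_deriveD (is_deriveD (is_derive_cst (p0 t) e (1 : R)) H1) H3.
  by apply: is_derive_eq => /=; ring.
have dphiP e t : e \in `]-d, d[ -> t \in `[0, T] ->
    is_derive e (1 : R) (fun e => phi (P e t))
      (dphi (P e t) * (p1 t + 2 * e * p2 t)).
  move=> he ht; have H1 := Dphi _ (P_gt0 e t he ht); have H2 := dP e t.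
  exact: is_derive1_comp.
have h0 : (0 : R) \in `]-d, d[ by rewrite in_itv /= oppr_lt0 d0.
have intP e : e \in `]-d, d[ ->
    mu.-integrable `[0, T] (EFin \o (fun t => phi (P e t))).
  move=> he; apply: continuous_compact_integrable; first exact: segment_compact.
  apply: continuous_in_subspaceT => t; rewrite inE => ht.
  apply: (@continuous_comp _ _ _ (P e)).
    by apply: cvgD; [apply: cvgD|];
      [exact: c0|apply: cvgMr; exact: c1|apply: cvgMr; exact: c2].
  have [H _] := Dphi _ (P_gt0 e t he ht).
  exact/differentiable_continuous/derivable1_diffP.
(* [K] bounds [dphi], and [|p1 + 2 e p2| <= M1 + 2 M2 <= 3 M] because [|e| < d <= 1]. *)
have Gub e t : e \in `]-d, d[ -> t \in `[0, T] ->
    `|partial1of2 (fun e t => phi (P e t)) e t| <= K * (3 * M).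
  move=> he ht; rewrite /partial1of2.
  have /is_derive1P[_ ->] := dphiP e t he ht.
  rewrite normrM ler_pM//; first by apply: HK; rewrite in_itv /=; exact: Pbnd.
  have /ler_normlP[? ?] := HM1 t ht.
  have : `|e * p2 t| <= M2.
    rewrite normrM -[leRHS]mul1r ler_pM// ?HM2//.
    by move: he; rewrite /= in_itv /= -ltr_norml => he; lra.
  move=> /ler_normlP[? ?]; apply/ler_normlP; rewrite /M.
  by split; lra.
have K0 : forall y : R, 0 <= K * (3 * M) by move=> _; rewrite !mulr_ge0// ltW.
have derf : forall e t, e \in `]-d, d[ -> t \in `[0, T] ->
    derivable ((fun e t => phi (P e t)) ^~ t) e 1.
  by move=> e t he ht; have [] := dphiP e t he ht.
have intK : mu.-integrable `[0, T] (EFin \o (fun=> K * (3 * M))).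
  by apply: continuous_integrable_itv => x; exact: cvg_cst.
have mT : measurable (`[0, T] : set (measurableTypeR R)) by [].
apply/is_derive1P; split.
  exact: (derivable_under_integral mT h0 intP derf K0 intK Gub).
rewrite (differentiation_under_integral mT h0 intP derf K0 intK Gub).
apply: eq_Rintegral => t; rewrite inE => ht.
rewrite /partial1of2; have /is_derive1P[_ ->] := dphiP 0 t h0 ht.
by rewrite /P mulr0 mul0r expr0n !mul0r !addr0.
Qed.

End integrals.

(** * First variation of the area and of the affine energy *)

Section first_variation.
Context {R : realType} {n : nat}.
Implicit Types (g v : R -> 'rV[R]_(n + n)).
Local Notation mu := (@lebesgue_measure R).

Lemma times_derivable_continuous {V : normedModType R} k (u : R -> V) :
  times_derivable k.+1 u -> continuous u.
Proof. by move=> [du _]; exact: derivable_continuous. Qed.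

Lemma smooth_times_derivable m (u : R -> 'rV[R]_m) : smooth u ->
  forall j k, times_derivable k (derive1n j u).
Proof.
move=> Hu j; apply/smoothP => k t.
rewrite (_ : derive1n k (derive1n j u) = derive1n (k + j) u); first exact: Hu.
by rewrite /derive1n iterD.
Qed.

Lemma smooth_is_derive m (u : R -> 'rV[R]_m) : smooth u ->
  forall (j : nat) (t : R),
    is_derive t (1 : R) (derive1n j u) (derive1n j.+1 u t).
Proof. by move=> Hu j t; rewrite derive1nS; apply: derivable_is_derive1. Qed.

Lemma derive1n_perturbation g v (e : R) (j : nat) : smooth g -> smooth v ->
  derive1n j (fun t => g t + e *: v t) =
  (fun t => derive1n j g t + e *: derive1n j v t).
Proof.
move=> Hg Hv; elim: j => [//|j IH]; rewrite derive1nS IH.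
apply: is_derive1_funext => t.
have H1 := smooth_is_derive _ _ Hg j t.
have H2 := smooth_is_derive _ _ Hv j t.
exact: is_deriveD H1 (is_deriveZ e H2).
Qed.

Lemma omega_perturbation (u u' w w' : 'rV[R]_(n + n)) (e : R) :
  omega (u + e *: w) (u' + e *: w') =
  omega u u' + e * (omega w u' + omega u w') + e ^+ 2 * omega w w'.
Proof. by rewrite !omegaE; ring. Qed.

(** Covers both functionals: [j = 0] with the identity gives the area, [j = 1] with the power [a]
    gives the affine energy. The coefficient of [e] in [omega_perturbation] is the linear term of
    the integrand. *)
Lemma is_derive_functional (T : R) (phi dphi : R -> R) (j : nat) g v : 0 < T ->
  (forall x : R, 0 < x -> is_derive x (1 : R) phi (dphi x)) ->
  (forall x : R, 0 < x -> {for x, continuous dphi}) ->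
  smooth g -> smooth v ->
  (forall t, 0 < omega (derive1n j g t) (derive1n j.+1 g t)) ->
  is_derive (0 : R) (1 : R)
    (fun e => \int[mu]_(t in `[0, T])
       phi (omega (derive1n j (fun t => g t + e *: v t) t)
                  (derive1n j.+1 (fun t => g t + e *: v t) t)))
    (\int[mu]_(t in `[0, T])
       (dphi (omega (derive1n j g t) (derive1n j.+1 g t)) *
        (omega (derive1n j v t) (derive1n j.+1 g t) +
         omega (derive1n j g t) (derive1n j.+1 v t)))).
Proof.
move=> T0 Dphi cdphi Hg Hv gj.
have Dg := smooth_times_derivable _ _ Hg.
have Dv := smooth_times_derivable _ _ Hv.
under eq_fun do under eq_Rintegral do
  rewrite !derive1n_perturbation// omega_perturbation.
apply: is_derive_Rintegral_comp => //.
all: apply: (times_derivable_continuous 0); try apply: times_derivableD.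
all: by apply: times_derivable_omega; [exact: Dg || exact: Dv ..].
Qed.

Lemma critical_curve_Rintegral (T a : R) g : 0 < T -> curve_space T g ->
  critical_curve T a g ->
  exists lambda : R, forall v, smooth_periodic T v ->
    \int[mu]_(t in `[0, T])
      (lambda * (omega (v t) (derive1n 1 g t) + omega (g t) (derive1n 1 v t)) +
       a * omega (derive1n 1 g t) (derive1n 2 g t) `^ (a - 1) *
         (omega (derive1n 1 v t) (derive1n 2 g t) +
          omega (derive1n 1 g t) (derive1n 2 v t))) = 0.
Proof.
move=> T0 [[Hg gT] star conv] [lambda Hl]; exists lambda => v vsp.
have [Hv vT] := vsp.
have Dg := smooth_times_derivable _ _ Hg.
have Dv := smooth_times_derivable _ _ Hv.
have [_ D0] := Hl v vsp.
have HA : is_derive (0 : R) (1 : R) (fun e => area T (fun t => g t + e *: v t))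
    (\int[mu]_(t in `[0, T])
      (omega (v t) (derive1n 1 g t) + omega (g t) (derive1n 1 v t))).
  (* The factor 1 is the derivative of the identity, in the place of [dphi]. *)
  under eq_Rintegral do rewrite -[_ + _]mul1r.
  apply: (@is_derive_functional T id (fun=> 1) 0) => // x _.
  exact: cvg_cst.
have HB : is_derive (0 : R) (1 : R)
    (fun e => affine_energy T a (fun t => g t + e *: v t))
    (\int[mu]_(t in `[0, T])
      (a * omega (derive1n 1 g t) (derive1n 2 g t) `^ (a - 1) *
         (omega (derive1n 1 v t) (derive1n 2 g t) +
          omega (derive1n 1 g t) (derive1n 2 v t)))).
  apply: (@is_derive_functional T
    (fun x => x `^ a) (fun x => a * x `^ (a - 1)) 1) => //.
  move=> x x0; apply: cvgM; first exact: cvg_cst.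
  have [/derivable1_diffP dpow _] := is_derive1_powR (a - 1) x0.
  exact: differentiable_continuous dpow.
have [_ DE] := is_deriveD (is_deriveZ lambda HA) HB.
have dA : times_derivable 1 (fun t =>
    omega (v t) (derive1n 1 g t) + omega (g t) (derive1n 1 v t)).
  apply: times_derivableD.
    exact: (times_derivable_omega _ _ _ _ (Dv 0 1) (Dg 1 1)).
  exact: (times_derivable_omega _ _ _ _ (Dg 0 1) (Dv 1 1)).
have mT : measurable (`[0, T] : set (measurableTypeR R)) by [].
(* The derivative at [e = 0] is known twice: it is 0 by criticality, and it is the combination of
   the two first variations [HA] and [HB]. *)
rewrite -[RHS]D0 [RHS]DE [_ *: _]/GRing.scale /= -RintegralZl//; last first.
  apply: continuous_integrable_itv; exact: times_derivable_continuous dA.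
rewrite -RintegralD//.
  apply: continuous_integrable_itv; apply: (times_derivable_continuous 0).
  by apply: times_derivableM dA; exact: times_derivable_cst.
apply: continuous_integrable_itv; apply: (times_derivable_continuous 0).
apply: times_derivableM; last first.
  apply: times_derivableD.
    exact: (times_derivable_omega _ _ _ _ (Dv 1 1) (Dg 2 1)).
  exact: (times_derivable_omega _ _ _ _ (Dg 1 1) (Dv 2 1)).
apply: times_derivableM; first exact: times_derivable_cst.
apply: times_derivable_powR => //.
exact: (times_derivable_omega _ _ _ _ (Dg 1 1) (Dg 2 1)).
Qed.

End first_variation.

(** * The Euler-Lagrange equation, integrated once *)

Section euler_lagrange.
Context {R : realType} {n : nat}.
Local Notation mu := (@lebesgue_measure R).

(** Periodicity brings [t] to some [s] in [[0, T]], and the mean value theorem on [[0, s]],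
    coordinate by coordinate, evaluates the derivative at interior points only. The open interval
    matches what [continuous_Rintegral_eq0] provides. *)
Lemma periodic_derive0_cst m (T : R) (w : R -> 'rV[R]_m) : 0 < T ->
  periodic w T -> (forall t : R, derivable w t (1 : R)) ->
  (forall t, 0 < t < T -> derive1 w t = 0) -> forall t, w t = w 0.
Proof.
move=> T0 wT dw w0 t; have [s + ->] := periodic_itv T w T0 wT t.
rewrite in_itv /= => /andP[+ sT]; rewrite le_eqVlt => /predU1P[<-//|s0].
apply/rowP => j; pose y t := w t 0 j.
have Dy x : is_derive x (1 : R) y (derive1 w x 0 j).
  by have /is_derive_mxP := derivable_is_derive1 w x (dw x); exact.
have [|x] := @MVT R y (fun x => derive1 w x 0 j) 0 s s0 (fun x _ => Dy x).
  apply: continuous_subspaceT; apply: derivable_continuous => x.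
  by have [] := Dy x.
rewrite in_itv /= => /andP[x0 xs]; rewrite w0 ?x0 ?(lt_le_trans xs)//.
by rewrite mxE mul0r => /eqP; rewrite subr_eq0 => /eqP.
Qed.

(** The pointwise identity [G' = E + N] of the next proof: indices count derivatives at a fixed
    time, and [q1] stands for the derivative of [q = 2 f g'' + f' g']. The terms in [f1] cancel by
    antisymmetry. *)
Lemma variation_by_parts (g0 g1 g2 v0 v1 v2 q1 : 'rV[R]_(n + n)) (l f f1 : R) :
  l * (omega g1 v0 + omega g0 v1)
  + (omega (f1 *: g1 + f *: g2) v1 + omega (f *: g1) v2)
  + (omega v1 ((2 * f) *: g2 + f1 *: g1) + omega v0 q1) =
  l * (omega v0 g1 + omega g0 v1) + f * (omega v1 g2 + omega g1 v2)
  + omega v0 (q1 + (- (2 * l)) *: g1).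
Proof.
rewrite !omegaE (omegaC g1 v0) (omegaC g1 v1) (omegaC g2 v1); ring.
Qed.

Lemma euler_lagrange (T a : R) (g : R -> 'rV[R]_(n + n)) : 0 < T ->
  curve_space T g -> critical_curve T a g ->
  exists (lambda : R) (c : 'rV[R]_(n + n)), forall t,
    let f t := a * omega (derive1n 1 g t) (derive1n 2 g t) `^ (a - 1) in
    (2 * f t) *: derive1n 2 g t + derive1 f t *: derive1n 1 g t
    = (2 * lambda) *: g t + c.
Proof.
move=> T0 Cg /(critical_curve_Rintegral _ _ _ T0 Cg)[lambda crit].
have [[Hg gT] star conv] := Cg.
have gjT j : periodic (derive1n j g) T.
  by elim: j => [//|j IH]; rewrite derive1nS; exact: periodic_derive1.
have Dg := smooth_times_derivable _ _ Hg.
pose h t := omega (derive1n 1 g t) (derive1n 2 g t).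
pose f t := a * h t `^ (a - 1).
pose q t := (2 * f t) *: derive1n 2 g t + derive1 f t *: derive1n 1 g t.
pose w t := q t + (- (2 * lambda)) *: g t.
have Df k : times_derivable k f.
  apply: times_derivableM; first exact: times_derivable_cst.
  by apply: times_derivable_powR => //; apply: times_derivable_omega; exact: Dg.
have fT : periodic f T by move=> t; rewrite /f /h !gjT.
have f1T : periodic (derive1 f) T by exact: periodic_derive1.
have Dq k : times_derivable k q.
  apply: times_derivableD; apply: times_derivableZ; try exact: Dg.
    by apply: times_derivableM; [exact: times_derivable_cst|exact: Df].
  by have [] := Df k.+1.
have Dw k : times_derivable k w.
  apply: times_derivableD => //; apply: times_derivableZ; last exact: (Dg 0).
  exact: times_derivable_cst.
have wT : periodic w T by move=> t; rewrite /w /q fT f1T !gjT gT.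
pose v t := compatible_J (derive1 w t).
have Dw1 k : times_derivable k (derive1 w) by have [] := Dw k.+1.
have Hv : smooth v by apply/smoothP => k; exact: times_derivable_J.
have vT : periodic v T by move=> t; rewrite /v (periodic_derive1 _ _ wT).
have vjT j : periodic (derive1n j v) T.
  by elim: j => [//|j IH]; rewrite derive1nS; exact: periodic_derive1.
have Dv := smooth_times_derivable _ _ Hv.
pose E t :=
  lambda * (omega (v t) (derive1n 1 g t) + omega (g t) (derive1n 1 v t)) +
  f t * (omega (derive1n 1 v t) (derive1n 2 g t) +
         omega (derive1n 1 g t) (derive1n 2 v t)).
have DE k : times_derivable k E.
  apply: times_derivableD; apply: times_derivableM; rewrite //.
  - exact: times_derivable_cst.
  - apply: times_derivableD; apply: times_derivable_omega;
    [exact: (Dv 0)|exact: (Dg 1)|exact: (Dg 0)|exact: (Dv 1)].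
  - apply: times_derivableD; apply: times_derivable_omega;
    [exact: (Dv 1)|exact: (Dg 2)|exact: (Dg 1)|exact: (Dv 2)].
have IE : \int[mu]_(t in `[0, T]) E t = 0 by exact: crit.
pose N t := omega (v t) (derive1 w t).
have DN k : times_derivable k N.
  by apply: times_derivable_omega; [exact: (Dv 0)|].
(* The boundary term of the integrations by parts. It is periodic with derivative [E + N], so the
   integral of [E + N] over a period is 0; the integral of [E] is 0 by criticality, hence so is that
   of [N]. *)
pose G t := lambda * omega (g t) (v t)
  + omega (f t *: derive1n 1 g t) (derive1n 1 v t)
  + omega (v t) (q t).
have GT : periodic G T.
  by move=> t; rewrite /G /q !vjT !gjT fT f1T vT gT.
have HG t : is_derive t (1 : R) G (E t + N t).
  have Hg0 := smooth_is_derive _ _ Hg 0 t.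
  have Hg1 := smooth_is_derive _ _ Hg 1 t.
  have Hv0 := smooth_is_derive _ _ Hv 0 t.
  have Hv1 := smooth_is_derive _ _ Hv 1 t.
  have Hf : is_derive t (1 : R) f (derive1 f t).
    by apply: derivable_is_derive1; have [] := Df 1.
  have Hq : is_derive t (1 : R) q (derive1 q t).
    by apply: derivable_is_derive1; have [] := Dq 1.
  have Hw := is_deriveD Hq (is_deriveZ (- (2 * lambda)) Hg0).
  have w1 : derive1 w t = derive1 q t + (- (2 * lambda)) *: derive1n 1 g t.
    by have /is_derive1P[] := Hw.
  have H := is_deriveD (is_deriveD
     (is_deriveZ lambda (is_derive_omega _ _ _ _ _ _ Hg0 Hv0))
     (is_derive_omega _ _ _ _ _ _ (is_derive_scale _ _ _ _ _ _ Hf Hg1) Hv1))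
     (is_derive_omega _ _ _ _ _ _ Hv0 Hq).
  by apply: is_derive_eq; rewrite /N w1; exact: variation_by_parts.
have IN : \int[mu]_(t in `[0, T]) N t = 0.
  have intE : mu.-integrable `[0, T] (EFin \o E).
    apply: continuous_integrable_itv.
    exact: times_derivable_continuous (DE 1).
  have intN : mu.-integrable `[0, T] (EFin \o N).
    apply: continuous_integrable_itv.
    exact: times_derivable_continuous (DN 1).
  have mT : measurable (`[0, T] : set (measurableTypeR R)) by [].
  have := Rintegral_derive_periodic _ _ _ T0 HG.
  rewrite (RintegralD mT intE intN) IE add0r; apply => //.
  by apply: times_derivable_continuous (times_derivableD _ _ _ (DE 1) (DN 1)).
exists lambda, (w 0) => t; change (q t = (2 * lambda) *: g t + w 0).
have -> : w 0 = w t.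
  apply/esym; apply: (periodic_derive0_cst _ T) => //; first by have [] := Dw 1.
  (* By the choice of [v], [N] is the squared norm of [w']: it is continuous and nonnegative with
     zero integral, so it vanishes inside the period. *)
  move=> s sT; apply: omega_J_eq0; rewrite -[LHS]/(N s).
  apply: (continuous_Rintegral_eq0 T) sT => //.
    exact: times_derivable_continuous (DN 1).
  by move=> x; exact: omega_J_ge0.
by rewrite /w scaleNr addrC subrK.
Qed.

End euler_lagrange.

(** * Symplectic planes and planarity of solutions of the second-order equation *)

Section planarity.
Context {R : realType} {n : nat}.
Implicit Types u v : 'rV[R]_(n + n).

Lemma symplectic_span u v : omega u v != 0 ->
  \dim <<[:: u; v]>>%VS = 2%N /\ symplectic_subspace <<[:: u; v]>>%VS.
Proof.
move=> uv.
(* Pairing [x u + y v] with [u] isolates [y], and pairing it with [v] isolates [x]. This yields both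
   linear independence and non-degeneracy. *)
have coef0 (x y : R) : omega (x *: u + y *: v) u = 0 ->
    omega (x *: u + y *: v) v = 0 -> x = 0 /\ y = 0.
  rewrite !omegaE (omegaC v u) !mulr0 addr0 add0r => /eqP + /eqP.
  by rewrite !mulf_eq0 oppr_eq0 (negPf uv) !orbF => /eqP-> /eqP->.
split.
  suff : free [:: u; v] by rewrite /free => /eqP.
  apply/freeP => k; rewrite big_ord_recl big_ord1 /= => k0.
  have [] := coef0 (k 0) (k (lift ord0 0)).
  - by rewrite k0 omega0l.
  - by rewrite k0 omega0l.
  move=> k00 k01 i; case: (unliftP ord0 i) => [j|] ->//.
  by rewrite (ord1 j).
move=> w wU w0; move: (wU); rewrite span_cons => /memv_addP[x /vlineP[x' ->]].
move=> [y]; rewrite span_seq1 => /vlineP[y' ->] wE.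
have [||x0 y0] := coef0 x' y'; last by rewrite wE x0 y0 !scale0r addr0.
- by rewrite -wE w0// memv_span// !inE eqxx.
- by rewrite -wE w0// memv_span// !inE eqxx orbT.
Qed.

(** With [W = omega d d'] and [N = omega(u, d') d - omega(u, d) d'], the equation [d'' = x d - y d']
    gives [W' = - y W] and [N' = - y N], so [N / W] has derivative 0. The left-hand side is that
    derivative as the product rules produce it, the zeros being the derivative of the fixed vector
    [u]. *)
Lemma projection_derive0 (u d0 d1 d2 : 'rV[R]_(n + n)) (x y : R) :
  omega d0 d1 != 0 -> d2 = x *: d0 - y *: d1 ->
  (- omega d0 d1 ^- 2 * (omega d1 d1 + omega d0 d2)) *:
    (omega u d1 *: d0 + (- omega u d0) *: d1) +
  (omega d0 d1)^-1 *:
    ((omega 0 d1 + omega u d2) *: d0 + omega u d1 *: d1 +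
     (- (omega 0 d0 + omega u d1) *: d1 + (- omega u d0) *: d2)) = 0.
Proof.
move=> W0 ->; apply/rowP => j; rewrite !omegaE !omega0l !mxE.
by field.
Qed.

(* The projection [u |-> (omega u d' d - omega u d d') / omega d d'] onto the
   plane spanned by [d] and [d'] along its symplectic complement does not
   depend on time. *)
Lemma second_order_planar (d : R -> 'rV[R]_(n + n)) (f : R -> R) (lambda : R) :
  smooth d -> (forall t, f t != 0) ->
  (forall t, omega (d t) (derive1n 1 d t) != 0) ->
  (forall t, (2 * f t) *: derive1n 2 d t + derive1 f t *: derive1n 1 d t =
     (2 * lambda) *: d t) ->
  forall t, d t \in <<[:: d 0%R; derive1n 1 d 0%R]>>%VS.
Proof.
move=> Hd f0 W0 ode t.
pose W s := omega (d s) (derive1n 1 d s).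
pose N u s :=
  omega u (derive1n 1 d s) *: d s + (- omega u (d s)) *: derive1n 1 d s.
(* The equation solved for the second derivative, which is possible since [f] never vanishes. *)
have d2 s : derive1n 2 d s =
    (lambda / f s) *: d s - (derive1 f s / (2 * f s)) *: derive1n 1 d s.
  have := ode s => /(congr1 (fun u => (2 * f s)^-1 *: u)).
  have f2 : 2 * f s != 0 by rewrite mulf_neq0.
  rewrite scalerDr !scalerA mulVf// scale1r => /eqP.
  rewrite eq_sym -subr_eq => /eqP <-.
  by congr (_ *: _ - _ *: _); field; rewrite ?f0.
have cst u : forall s r, (W s)^-1 *: N u s = (W r)^-1 *: N u r.
  apply: derive0_cst => s.
  have Hd0 := smooth_is_derive _ _ Hd 0 s.
  have Hd1 := smooth_is_derive _ _ Hd 1 s.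
  have Hu := is_derive_cst u s (1 : R).
  have HW := is_derive_omega _ _ _ _ _ _ Hd0 Hd1.
  have Ho1 := is_derive_omega _ _ _ _ _ _ Hu Hd1.
  have Ho0 := is_deriveN (is_derive_omega _ _ _ _ _ _ Hu Hd0).
  have HN := is_deriveD (is_derive_scale _ _ _ _ _ _ Ho1 Hd0)
                        (is_derive_scale _ _ _ _ _ _ Ho0 Hd1).
  have HV := is_deriveV (W0 s) HW.
  have H := is_derive_scale _ _ _ _ _ _ HV HN.
  by apply: is_derive_eq; exact: (projection_derive0 _ _ _ _ _ _ (W0 s) (d2 s)).
(* The projection at time [t] fixes [d t]; being independent of time, so does the projection at time
   0, whose image is the span of [d 0] and [d' 0]. *)
have -> : d t = (W 0)^-1 *: N (d t) 0.
  rewrite -(cst _ t) /N omegaxx oppr0 scale0r addr0 scalerA mulVf ?scale1r//.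
  exact: W0.
by rewrite memvZ// memvD// memvZ// memv_span// !inE eqxx ?orbT.
Qed.

End planarity.

Theorem proposition3p4 (R : realType) (n : nat) (a T : R)
    (g : R -> 'rV[R]_(n + n)) (hn : (1 <= n)%N) (ha : a != 0) (hT : 0 < T)
    (hg : curve_space T g) (hcrit : critical_curve T a g) :
  exists (p : 'rV[R]_(n + n)) (U : {vspace 'rV[R]_(n + n)}),
    [/\ \dim U = 2%N, symplectic_subspace U & forall t : R, g t - p \in U].
Proof.
have [[Hg gT] star conv] := hg.
have [lambda [c EL]] := euler_lagrange T a g hT hg hcrit.
pose h t := omega (derive1n 1 g t) (derive1n 2 g t).
pose f t := a * h t `^ (a - 1).
have {}EL t : (2 * f t) *: derive1n 2 g t + derive1 f t *: derive1n 1 g t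
    = (2 * lambda) *: g t + c by exact: EL.
have h0 t : 0 < h t by exact: conv.
(* Here [a != 0] enters, together with symplectic convexity, which makes the power positive. *)
have f0 t : f t != 0 by rewrite mulf_neq0// gt_eqF// powR_gt0.
(* Pairing with [g'] eliminates the [f'] term and leaves [2 f h]. *)
have ELg1 t : omega (derive1n 1 g t) ((2 * lambda) *: g t + c) = 2 * f t * h t.
  by rewrite -EL !omegaE mulr0 addr0.
have fh0 t : 2 * f t * h t != 0.
  by apply: mulf_neq0; [apply: mulf_neq0|rewrite gt_eqF].
have [l0|l0] := eqVneq lambda 0.
  have Dk t : is_derive t (1 : R) (fun t => omega (g t) c) (2 * f t * h t).
    have H := is_derive_omega _ _ _ _ _ _ (smooth_is_derive _ _ Hg 0 t)
      (is_derive_cst c t (1 : R)).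
    apply: is_derive_eq; rewrite -ELg1 l0 mulr0 scale0r add0r /cst.
    by rewrite (omegaC _ 0) omega0l oppr0 addr0.
  (* Periodicity gives equal values of [omega (g t) c] at 0 and [T], so its derivative would vanish
     somewhere, against [fh0]. *)
  have [|||t _ [_]] := @Rolle R (fun t => omega (g t) c) 0 T hT.
  - by move=> t _; have [] := Dk t.
  - apply: continuous_subspaceT; apply: derivable_continuous => t.
    by have [] := Dk t.
  - by rewrite -[T in RHS]add0r gT.
  by have [_ ->] := Dk t => /eqP; rewrite (negPf (fh0 t)).
(* This translation absorbs [c]: [(2 * lambda) *: (g t - p) = (2 * lambda) *: g t + c]. *)
pose p : 'rV[R]_(n + n) := (- (2 * lambda)^-1) *: c.
pose d t := g t - p.
have l2 : 2 * lambda != 0 by rewrite mulf_neq0.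
have dg j : derive1n j.+1 d = derive1n j.+1 g.
  rewrite !derive1Sn; congr derive1n; apply: is_derive1_funext => t.
  have := is_deriveB (smooth_is_derive _ _ Hg 0 t) (is_derive_cst p t (1 : R)).
  by rewrite subr0.
have ode t : (2 * f t) *: derive1n 2 d t + derive1 f t *: derive1n 1 d t =
    (2 * lambda) *: d t.
  by rewrite !dg EL scalerBr scalerA mulrN mulfV// scaleN1r opprK.
(* By [ELg1], [omega] of [d'] and [2 lambda d] equals [2 f h], which is nonzero. *)
have W0 t : omega (d t) (derive1n 1 d t) != 0.
  have := fh0 t; rewrite -ELg1 -EL -!dg ode.
  rewrite omegaC omegaZl oppr_eq0 mulf_eq0 negb_or.
  by case/andP.
have Hd : smooth d.
  move=> [|k] t; last by rewrite dg; exact: Hg.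
  by apply: derivableB; [exact: (Hg 0)|exact: derivable_cst].
have [dimU symU] := symplectic_span _ _ (W0 0).
exists p, <<[:: d 0%R; derive1n 1 d 0%R]>>%VS; split => //.
exact: second_order_planar Hd f0 W0 ode.
Qed.
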